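(* Let $R$ be a commutative ring with unity and let $I$ be an ideal of $R$ with $I\neq (0)$ and $I\neq R$. Let $R\Join I=\{(r,r+i)\mid r\in R,\ i\in I\}\subseteq R\times R$. **(1)** Let $P$ be a prime ideal of $R$ and consider the ideals $\mathcal{P}_1,\mathcal{P}_2,\mathcal{P}_0,\mathcal{P}$ of $R\Join I$ associated to $P$ (defined in the context). Then: (1,a) $\mathcal{P}_1$ and $\mathcal{P}_2$ are the only prime ideals of $R\Join I$ lying over $P$. (1,b) If $P\supseteq I$, then $\mathcal{P}_1=\mathcal{P}_2=\mathcal{P}=\sqrt{\mathcal{P}_0}=P\Join I$, where $P\Join I:=\{(p,p+i)\mid p\in P,\ i\in I\}$. Moreover, $\boldsymbol{k}_R(P)\cong \boldsymbol{k}_{R\Join I}(\mathcal{P})$. (1,c) If $P\not\supseteq I$, then $\mathcal{P}_1\neq\mathcal{P}_2$. Moreover, $\mathcal{P}=\sqrt{\mathcal{P}_0}$ and $\boldsymbol{k}_R(P)\cong \boldsymbol{k}_{R\Join I}(\mathcal{P}_1)\cong \boldsymbol{k}_{R\Join I}(\mathcal{P}_2)$. (1,d) If $P$ is a maximal ideal of $R$, then $\mathcal{P}_1$ and $\mathcal{P}_2$ are maximal ideals of $R\Join I$. (1,e) If $R$ is a local ring with maximal ideal $M$, then $R\Join I$ is a local ring with maximal ideal $\mathcal{M}=\sqrt{\mathcal{M}_0}=M\Join I$, where $\mathcal{M}$, $\mathcal{M}_0$ and $M\Join I$ are defined as for $P$, with $P$ replaced by $M$. (1,f) $R$ is reduced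 if and only if $R\Join I$ is reduced. **(2)** Let $\mathcal{Q}$ be a prime ideal of $R\Join I$ and let $\mathfrak{O}_1=(0)\times I$. Two cases are possible: either $\mathcal{Q}\not\supseteq\mathfrak{O}_1$ or $\mathcal{Q}\supseteq\mathfrak{O}_1$. (2,a) If $\mathcal{Q}\not\supseteq\mathfrak{O}_1$, then there exists a unique prime ideal $Q$ of $R\times R$ such that $\mathcal{Q}=Q\cap (R\Join I)$, and $Q=R\times P$, where $P:=\mathcal{Q}\cap R$ (and $P\not\supseteq I$). In this case, $\mathcal{P}_1\neq\mathcal{P}_2$ and $$\mathcal{Q}=\mathcal{P}_2=\{(p+i,p)\mid p\in P,\ i\in I\}.$$ Furthermore, the canonical ring homomorphisms $R\Join I\hookrightarrow R\times R\xrightarrow{\pi_2}R$ induce on localizations the isomorphisms $$(R\Join I)_{\mathcal{Q}}\cong (R\times R)_{Q}=(R\times R)_{R\times P}\cong R_P$$ (thus $\boldsymbol{k}_{R\Join I}(\mathcal{Q})\cong\boldsymbol{k}_R(P)$). (2,b) If $\mathcal{Q}\supseteq\mathfrak{O}_1$, then there exists a unique prime ideal $P$ of $R$ such that $\mathcal{Q}=v'^{-1}(P)$ (equivalently, $P=v'(\mathcal{Q})$). If $P\supseteq I$, then $\mathcal{Q}=\mathcal{P}_1=\mathcal{P}_2$. If $P\not\supseteq I$, then $\mathcal{Q}=\mathcal{P}_1$ (and $\mathcal{P}_1\neq\mathcal{P}_2$). In both cases, $$\mathcal{Q}=\{(p,p+i)\mid p\in P,\ i\in I\}.$$ Furthermore,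 the canonical ring homomorphism $v':R\Join I\to R$ induces an isomorphism $(R\Join I)/\mathcal{Q}\cong R/P$ (thus $\boldsymbol{k}_{R\Join I}(\mathcal{Q})\cong\boldsymbol{k}_R(P)$).
   Context: $R\Join I$ is a subring of $R\times R$. The ring $R$ is identified with its image in $R\Join I$ under the diagonal embedding $r\mapsto (r,r)$; for an ideal $\mathcal{H}$ of $R\Join I$ (or of $R\times R$), $\mathcal{H}\cap R$ denotes its contraction along this embedding, i.e. $\{r\in R\mid (r,r)\in\mathcal{H}\}$, and ''lying over $P$'' means $\mathcal{H}\cap R=P$. The map $u':R\Join I\hookrightarrow R\times R$ is the inclusion, $v':R\Join I\to R$ is $(r,r+i)\mapsto r$, and $\pi_2:R\times R\to R$ is the second projection. For an ideal $J$ of $R$ one sets: $\mathcal{J}_1:=v'^{-1}(J)$, $\mathcal{J}_2:=u'^{-1}(R\times J)$, $\mathcal{J}_0:=J(R\Join I)$ (the extension of $J$ to $R\Join I$), and $\mathcal{J}:=\mathcal{J}_1\cap\mathcal{J}_2$. For $J=P$ these are written $\mathcal{P}_1,\mathcal{P}_2,\mathcal{P}_0,\mathcal{P}$; for $J=M$ they are written $\mathcal{M}_1,\mathcal{M}_2,\mathcal{M}_0,\mathcal{M}$. For a prime ideal $Q$ of a ring $A$, $\boldsymbol{k}_A(Q):=A_Q/QA_Q$ denotes the residue field at $Q$. *)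

(* Defs.v *)
From HB Require Import structures.
From mathcomp Require Import all_boot all_algebra ring.
From mathcomp Require Import boolp.
From mathcomp Require Import generic_quotient ring_quotient.

Set Implicit Arguments.
Unset Strict Implicit.
Unset Printing Implicit Defensive.

Import GRing.Theory.
Local Open Scope ring_scope.
Local Open Scope quotient_scope.

(* Subsets of a ring are boolean predicates, compared with =i; Prop-valued
   conditions are reflected classically with `[< _ >].
   In ring_quotient, [idealr_closed], [idealr] and [prime_idealr] include
   properness (1 is not in the ideal). *)

Section Ideals.
Variable A : comNzRingType.
Implicit Types J M Q : {pred A}.

Definition prime_ideal Q : Prop := idealr_closed Q /\ prime_idealr_closed Q.

Definition maximal_ideal M : Prop :=
  idealr_closed M /\
  forall J, idealr_closed J -> {subset M <= J} -> J =i M.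

Definition local_with_maximal M : Prop :=
  maximal_ideal M /\ forall N : {pred A}, maximal_ideal N -> N =i M.

Definition radical J : {pred A} :=
  [pred x | `[< exists2 n : nat, (0 < n)%N & x ^+ n \in J >]].

Definition reduced : Prop := forall (x : A) (n : nat), x ^+ n = 0 -> x = 0.

End Ideals.

Arguments reduced A : clear implicits.

Definition ring_iso (A B : comNzRingType) : Prop :=
  exists f : {rmorphism A -> B}, bijective f.

Section IdealTransfer.
Variables A B : comNzRingType.

Definition preim_ideal (f : A -> B) (J : {pred B}) : {pred A} :=
  [pred a | f a \in J].

Definition image_set (f : A -> B) (J : {pred A}) : {pred B} :=
  [pred b | `[< exists2 a, a \in J & b = f a >]].

(* The extension of J along f : the ideal of B generated by f(J). *)
Definition ext_ideal (f : A -> B) (J : {pred A}) : {pred B} :=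
  [pred b | `[< exists n (c : 'I_n -> B) (x : 'I_n -> A),
                  (forall i, x i \in J) /\ b = \sum_i c i * f (x i) >]].

Section Preim.
Variables (f : {rmorphism A -> B}) (Q : prime_idealr B).

Fact preim_idealr_closed : idealr_closed (preim_ideal f Q).
Proof.
split=> [||a u v]; rewrite !inE ?rmorph0 ?rpred0 ?rmorph1 ?idealr1 //.
by move=> uQ vQ; rewrite rmorphD rmorphM rpredD ?idealMr.
Qed.

Fact preim_prime_idealr_closed : prime_idealr_closed (preim_ideal f Q).
Proof. by move=> u v; rewrite !inE rmorphM prime_idealrM. Qed.

HB.instance Definition _ :=
  isIdealr.Build A (preim_ideal f Q) preim_idealr_closed.
HB.instance Definition _ :=
  isPrimeIdealrClosed.Build A (preim_ideal f Q) preim_prime_idealr_closed.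
End Preim.

End IdealTransfer.

Fact ext_idealD (B C : comNzRingType) (f : B -> C) (J : {pred B}) (a u v : C) :
  u \in ext_ideal f J -> v \in ext_ideal f J -> a * u + v \in ext_ideal f J.
Proof.
rewrite !inE => /asboolP[n [c [x [xJ ->]]]] /asboolP[m [d [y [yJ ->]]]].
apply/asboolP; exists (n + m)%N.
exists (fun i => match split i with inl j => a * c j | inr j => d j end).
exists (fun i => match split i with inl j => x j | inr j => y j end).
split=> [i|]; first by case: splitP.
rewrite big_split_ord mulr_sumr /=; congr (_ + _); apply: eq_bigr => i _.
  by rewrite (unsplitK (inl i)) mulrA.
by rewrite (unsplitK (inr i)).
Qed.

Section Localization.
Variables (A : comNzRingType) (Q : prime_idealr A).

Record fraction :=
  Fraction { fraction_val :> A * A; _ : fraction_val.2 \notin Q }.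

HB.instance Definition _ := [isSub for fraction_val].
HB.instance Definition _ := [Choice of fraction by <:].

Fact one_notin : (1 : A) \notin Q.
Proof. by rewrite idealr1. Qed.

Fact mul_notin (s t : A) : s \notin Q -> t \notin Q -> s * t \notin Q.
Proof. by move=> sQ tQ; rewrite prime_idealrM negb_or sQ. Qed.

Fact fraction_den (x : fraction) : x.2 \notin Q. Proof. by case: x. Qed.

Definition mkfrac (a s : A) (sQ : s \notin Q) : fraction :=
  @Fraction (a, s) sQ.

Definition frac_equiv (x y : fraction) : bool :=
  `[< exists2 t, t \notin Q & t * (x.1 * y.2) = t * (y.1 * x.2) >].

Fact frac_equiv_refl : reflexive frac_equiv.
Proof. by move=> x; apply/asboolP; exists 1; rewrite ?one_notin. Qed.

Fact frac_equiv_sym : symmetric frac_equiv.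
Proof. by move=> x y; apply/asboolP/asboolP=> -[t tQ e]; exists t. Qed.

Fact frac_equiv_trans : transitive frac_equiv.
Proof.
move=> y x z /asboolP[t tQ e] /asboolP[u uQ e']; apply/asboolP.
exists (t * u * y.2); first by rewrite !mul_notin ?fraction_den.
transitivity (t * (x.1 * y.2) * (u * z.2)); first by ring.
rewrite e; transitivity (u * (y.1 * z.2) * (t * x.2)); first by ring.
by rewrite e'; ring.
Qed.

Canonical frac_equiv_equiv :=
  EquivRel frac_equiv frac_equiv_refl frac_equiv_sym frac_equiv_trans.

Definition localization := {eq_quot frac_equiv}.

HB.instance Definition _ : EqQuotient _ frac_equiv localization :=
  EqQuotient.on localization.
HB.instance Definition _ := Choice.on localization.

Fact frac_eqP (x y : fraction) :
  reflect (exists2 t, t \notin Q & t * (x.1 * y.2) = t * (y.1 * x.2))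
          (x == y %[mod localization]).
Proof. by rewrite eqmodE; apply: asboolP. Qed.

Fact frac_repr (x : fraction) :
  exists2 t, t \notin Q &
    t * ((repr (\pi_localization x)).1 * x.2) =
    t * (x.1 * (repr (\pi_localization x)).2).
Proof. by apply/frac_eqP; rewrite reprK. Qed.

Definition addf (x y : fraction) : fraction :=
  mkfrac (x.1 * y.2 + y.1 * x.2) (mul_notin (fraction_den x) (fraction_den y)).
Definition oppf (x : fraction) : fraction := mkfrac (- x.1) (fraction_den x).
Definition mulf (x y : fraction) : fraction :=
  mkfrac (x.1 * y.1) (mul_notin (fraction_den x) (fraction_den y)).

Definition loc_zero : localization := lift_cst localization (mkfrac 0 one_notin).
Definition loc_one : localization := lift_cst localization (mkfrac 1 one_notin).
Definition loc_add := lift_op2 localization addf.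
Definition loc_opp := lift_op1 localization oppf.
Definition loc_mul := lift_op2 localization mulf.

Canonical loc_zero_morph := PiConst loc_zero.
Canonical loc_one_morph := PiConst loc_one.

Fact pi_addf : {morph \pi : x y / addf x y >-> loc_add x y}.
Proof.
move=> x y; unlock loc_add; apply/eqP/frac_eqP => /=.
have [t tQ e] := frac_repr x; have [u uQ e'] := frac_repr y.
move: (repr (\pi x)) (repr (\pi y)) e e' => x' y' e e'.
exists (t * u); first exact: mul_notin.
transitivity (t * (x.1 * x'.2) * (u * y.2 * y'.2)
              + u * (y.1 * y'.2) * (t * x.2 * x'.2)); first by ring.
by rewrite -e -e'; ring.
Qed.
Canonical loc_add_morph := PiMorph2 pi_addf.

Fact pi_oppf : {morph \pi : x / oppf x >-> loc_opp x}.
Proof.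
move=> x; unlock loc_opp; apply/eqP/frac_eqP => /=.
have [t tQ e] := frac_repr x; move: (repr _) e => x' e.
by exists t => //; rewrite !mulNr !mulrN e.
Qed.
Canonical loc_opp_morph := PiMorph1 pi_oppf.

Fact pi_mulf : {morph \pi : x y / mulf x y >-> loc_mul x y}.
Proof.
move=> x y; unlock loc_mul; apply/eqP/frac_eqP => /=.
have [t tQ e] := frac_repr x; have [u uQ e'] := frac_repr y.
move: (repr (\pi x)) (repr (\pi y)) e e' => x' y' e e'.
exists (t * u); first exact: mul_notin.
transitivity (t * (x.1 * x'.2) * (u * (y.1 * y'.2))); first by ring.
by rewrite -e -e'; ring.
Qed.
Canonical loc_mul_morph := PiMorph2 pi_mulf.

Fact loc_addA : associative loc_add.
Proof.
elim/quotW=> x; elim/quotW=> y; elim/quotW=> z; rewrite !piE.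
by apply/eqP/frac_eqP; exists 1; rewrite ?one_notin //=; ring.
Qed.

Fact loc_addC : commutative loc_add.
Proof.
elim/quotW=> x; elim/quotW=> y; rewrite !piE.
by apply/eqP/frac_eqP; exists 1; rewrite ?one_notin //=; ring.
Qed.

Fact loc_add0 : left_id loc_zero loc_add.
Proof.
elim/quotW=> x; rewrite !piE.
by apply/eqP/frac_eqP; exists 1; rewrite ?one_notin //=; ring.
Qed.

Fact loc_addN : left_inverse loc_zero loc_opp loc_add.
Proof.
elim/quotW=> x; rewrite !piE.
by apply/eqP/frac_eqP; exists 1; rewrite ?one_notin //=; ring.
Qed.

HB.instance Definition _ :=
  GRing.isZmodule.Build localization loc_addA loc_addC loc_add0 loc_addN.

Fact loc_mulA : associative loc_mul.
Proof.
elim/quotW=> x; elim/quotW=> y; elim/quotW=> z; rewrite !piE.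
by apply/eqP/frac_eqP; exists 1; rewrite ?one_notin //=; ring.
Qed.

Fact loc_mulC : commutative loc_mul.
Proof.
elim/quotW=> x; elim/quotW=> y; rewrite !piE.
by apply/eqP/frac_eqP; exists 1; rewrite ?one_notin //=; ring.
Qed.

Fact loc_mul1 : left_id loc_one loc_mul.
Proof.
elim/quotW=> x; rewrite !piE.
by apply/eqP/frac_eqP; exists 1; rewrite ?one_notin //=; ring.
Qed.

Fact loc_mulDl : left_distributive loc_mul loc_add.
Proof.
elim/quotW=> x; elim/quotW=> y; elim/quotW=> z; rewrite !piE.
by apply/eqP/frac_eqP; exists 1; rewrite ?one_notin //=; ring.
Qed.

Fact loc_one_neq0 : loc_one != loc_zero.
Proof.
rewrite !piE; apply/asboolP => -[t tQ /=]; rewrite !mulr1 mulr0 => t0.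
by move: tQ; rewrite t0 rpred0.
Qed.

HB.instance Definition _ := GRing.Zmodule_isComNzRing.Build localization
  loc_mulA loc_mulC loc_mul1 loc_mulDl loc_one_neq0.

Definition locfrac (a s : A) (sQ : s \notin Q) : localization :=
  \pi_localization (mkfrac a sQ).

Definition to_loc (a : A) : localization := locfrac a one_notin.

Fact to_loc_is_zmod_morphism : zmod_morphism to_loc.
Proof.
move=> a b; rewrite /to_loc /locfrac -[X in _ = _ + X]pi_oppf -[RHS]pi_addf.
by apply/eqP/frac_eqP; exists 1; rewrite ?one_notin //=; ring.
Qed.
HB.instance Definition _ :=
  GRing.isZmodMorphism.Build A localization to_loc to_loc_is_zmod_morphism.

Fact to_loc_is_monoid_morphism : monoid_morphism to_loc.
Proof.
split=> [|a b]; rewrite /to_loc /locfrac; first by rewrite -[RHS]/loc_one piE.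
rewrite -[RHS]pi_mulf.
by apply/eqP/frac_eqP; exists 1; rewrite ?one_notin //=; ring.
Qed.
HB.instance Definition _ :=
  GRing.isMonoidMorphism.Build A localization to_loc to_loc_is_monoid_morphism.

(* The ideal Q A_Q. *)
Definition loc_ideal : {pred localization} := ext_ideal to_loc Q.

Fact loc_idealP (z : localization) :
  z \in loc_ideal ->
  exists a s (sQ : s \notin Q), a \in Q /\ z = locfrac a sQ.
Proof.
rewrite inE => /asboolP[n [c [x [xQ ->]]]].
elim/big_ind: _ => [|_ _ [a [s [sQ [aQ ->]]]] [b [t [tQ [bQ ->]]]]|i _].
- by exists 0, 1, one_notin; rewrite rpred0; split=> //; rewrite -[LHS]/loc_zero piE.
- exists (a * t + b * s), (s * t), (mul_notin sQ tQ).
  rewrite rpredD ?[_ * t]mulrC ?[_ * s]mulrC ?idealMr //; split=> //.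
  rewrite -[LHS]pi_addf; apply/eqP/frac_eqP; exists 1; rewrite ?one_notin //=.
  by ring.
- elim/quotW: (c i) => y.
  exists (y.1 * x i), y.2, (fraction_den y); rewrite idealMr //; split=> //.
  rewrite -[LHS]pi_mulf; apply/eqP/frac_eqP; exists 1; rewrite ?one_notin //=.
  by ring.
Qed.

Fact loc_ideal_closed : idealr_closed loc_ideal.
Proof.
split=> [||a u v uQ vQ]; last exact: ext_idealD.
  rewrite inE; apply/asboolP; exists 0%N, (fun=> 0), (fun=> 0).
  by split=> [[]|]; rewrite ?big_ord0.
apply/negP => /loc_idealP[a [s [sQ [aQ]]]].
rewrite -(rmorph1 to_loc) => /eqP/frac_eqP[t tQ /=].
rewrite mul1r mulr1 => e.
by move: (mul_notin tQ sQ); rewrite e idealMr.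
Qed.

HB.instance Definition _ :=
  isIdealr.Build localization loc_ideal loc_ideal_closed.

Definition residue_field : Type := {ideal_quot loc_ideal}.
HB.instance Definition _ := GRing.ComNzRing.on residue_field.

End Localization.

(* The ring homomorphism f : A -> B induces an isomorphism A_Q -> B_Q'
   (resp. A/Q -> B/Q'), that is, an isomorphism commuting with f and the
   canonical maps. *)
Definition induces_loc_iso (A B : comNzRingType) (f : A -> B)
    (Q : prime_idealr A) (Q' : prime_idealr B) : Prop :=
  exists2 g : {rmorphism localization Q -> localization Q'},
    bijective g & forall a, g (to_loc Q a) = to_loc Q' (f a).

Definition induces_quot_iso (A B : comNzRingType) (f : A -> B)
    (Q : prime_idealr A) (Q' : prime_idealr B) : Prop :=
  exists2 g : {rmorphism {ideal_quot Q} -> {ideal_quot Q'}},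
    bijective g &
    forall a, g (\pi_{ideal_quot Q} a) = \pi_{ideal_quot Q'} (f a).

Section Duplication.
Variable R : comNzRingType.

(* {(p, p + i) | p in P, i in I} as a subset of R x R. *)
Definition dup_set (P I : {pred R}) : {pred R * R} :=
  [pred x | `[< exists p i, [/\ p \in P, i \in I & x = (p, p + i)] >]].

Section Ring.
Variable I : idealr R.

Fact dup_set_subring : subring_closed (dup_set predT I).
Proof.
split; first by apply/asboolP; exists 1, 0; rewrite rpred0 addr0.
- move=> _ _ /asboolP[r [i [_ iI ->]]] /asboolP[s [j [_ jI ->]]].
  apply/asboolP; exists (r - s), (i - j); rewrite rpredB //; split=> //.
  by rewrite /= -[LHS]/(r - s, r + i - (s + j)); congr pair; ring.
- move=> _ _ /asboolP[r [i [_ iI ->]]] /asboolP[s [j [_ jI ->]]].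
  apply/asboolP; exists (r * s), (r * j + (s + j) * i).
  rewrite rpredD ?idealMr //; split=> //.
  by rewrite -[LHS]/(r * s, (r + i) * (s + j)); congr pair; ring.
Qed.

HB.instance Definition _ :=
  GRing.isSubringClosed.Build (R * R)%type (dup_set predT I) dup_set_subring.

Record duplication :=
  Duplication { dup_val : R * R; _ : dup_val \in dup_set predT I }.

HB.instance Definition _ := [isSub for dup_val].
HB.instance Definition _ := [Choice of duplication by <:].
HB.instance Definition _ :=
  [SubChoice_isSubComNzRing of duplication by <:].

(* The inclusion u' : R ⋈ I -> R x R and v' : (r, r + i) |-> r. *)
Definition dup_incl : duplication -> R * R := val.
HB.instance Definition _ := GRing.RMorphism.on dup_incl.

Definition dup_proj (x : duplication) : R := (dup_incl x).1.
Fact dup_proj_is_zmod_morphism : zmod_morphism dup_proj.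
Proof. by []. Qed.
Fact dup_proj_is_monoid_morphism : monoid_morphism dup_proj.
Proof. by []. Qed.
HB.instance Definition _ :=
  GRing.isZmodMorphism.Build duplication R dup_proj dup_proj_is_zmod_morphism.
HB.instance Definition _ :=
  GRing.isMonoidMorphism.Build duplication R dup_proj
    dup_proj_is_monoid_morphism.

Fact diag_subproof (r : R) : (r, r) \in dup_set predT I.
Proof. by apply/asboolP; exists r, 0; rewrite rpred0 addr0. Qed.

Definition dup_diag (r : R) : duplication := Duplication (diag_subproof r).
Fact dup_diag_is_zmod_morphism : zmod_morphism dup_diag.
Proof. by move=> r s; apply: val_inj. Qed.
Fact dup_diag_is_monoid_morphism : monoid_morphism dup_diag.
Proof. by split=> [|r s]; apply: val_inj. Qed.
HB.instance Definition _ :=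
  GRing.isZmodMorphism.Build R duplication dup_diag dup_diag_is_zmod_morphism.
HB.instance Definition _ :=
  GRing.isMonoidMorphism.Build R duplication dup_diag
    dup_diag_is_monoid_morphism.

(* J_1 = v'^-1(J), J_2 = u'^-1(R x J), J_0 = J(R ⋈ I), J_1 ∩ J_2. *)
Definition dup_ideal1 (J : {pred R}) : {pred duplication} :=
  preim_ideal dup_proj J.
Definition dup_ideal2 (J : {pred R}) : {pred duplication} :=
  preim_ideal dup_incl [predX predT & J].
Definition dup_ideal0 (J : {pred R}) : {pred duplication} :=
  ext_ideal dup_diag J.
Definition dup_ideal (J : {pred R}) : {pred duplication} :=
  [predI dup_ideal1 J & dup_ideal2 J].

(* P ⋈ I, as a subset of R ⋈ I. *)
Definition dup_of (P : {pred R}) : {pred duplication} :=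
  preim_ideal dup_incl (dup_set P I).

(* (0) x I, as a subset of R ⋈ I. *)
Definition dup_O1 : {pred duplication} :=
  preim_ideal dup_incl [predX pred1 0 & I].

Definition contraction (H : {pred duplication}) : {pred R} :=
  preim_ideal dup_diag H.

HB.instance Definition _ (P : prime_idealr R) :=
  PrimeIdealr.copy (dup_ideal1 P) (preim_ideal dup_proj P).

HB.instance Definition _ (Q : prime_idealr duplication) :=
  PrimeIdealr.copy (contraction Q) (preim_ideal dup_diag Q).

Section P2.
Variable P : prime_idealr R.
Fact dup_ideal2_closed : idealr_closed (dup_ideal2 P).
Proof.
split=> [||a u v]; rewrite !inE /= ?rpred0 ?idealr1 //.
by move=> uP vP; rewrite rpredD ?idealMr.
Qed.
Fact dup_ideal2_prime : prime_idealr_closed (dup_ideal2 P).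
Proof. by move=> u v; rewrite !inE /= prime_idealrM. Qed.
HB.instance Definition _ :=
  isIdealr.Build duplication (dup_ideal2 P) dup_ideal2_closed.
HB.instance Definition _ :=
  isPrimeIdealrClosed.Build duplication (dup_ideal2 P) dup_ideal2_prime.
End P2.

End Ring.
End Duplication.

Arguments dup_incl {R} I _.
Arguments dup_proj {R} I _.
Arguments dup_ideal1 {R} I J.
Arguments dup_ideal2 {R} I J.
Arguments dup_ideal0 {R} I J.
Arguments dup_ideal {R} I J.
Arguments dup_of {R} I P.
Arguments dup_O1 {R} I.
Arguments contraction {R I} H.

Notation "R ⋈ I" := (@duplication R I) (at level 40) : type_scope.

(* Main.v *)
Require Import Defs.
From HB Require Import structures.
From mathcomp Require Import all_boot all_algebra.
From mathcomp Require Import generic_quotient ring_quotient.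
From mathcomp Require Import boolp classical_sets ring.

(* Everything rests on the orthogonality [(i, 0) * (0, j) = 0] in R ⋈ I.  If a
   prime Q of R ⋈ I misses some [(0, i)], it contains every [x - (x.2, x.2)]
   (their first components lie in I and their second ones vanish), hence
   membership in Q only depends on [x.2] and Q = P_2 for the contraction P of
   Q; otherwise Q contains every [x - (x.1, x.1)] and Q = P_1.  Since P_1 and
   P_2 are the preimages of P under the two surjective projections to R,
   maximality, residue fields and quotients transfer along these.  In the case
   Q = P_2, the element (0, i) outside Q multiplies R x R into R ⋈ I, so R ⋈ I
   and R x R have the same localization there; (0, 1) does the same for the
   second projection.  In the local case, Zorn's lemma puts I inside the
   unique maximal ideal. *)

Set Implicit Arguments.
Unset Strict Implicit.
Unset Printing Implicit Defensive.

Import GRing.Theory.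
Local Open Scope ring_scope.

(** * Bijections and ring isomorphisms *)

Lemma bijective_surj (T : choiceType) (U : eqType) (g : T -> U) :
  injective g -> (forall u, exists t, g t = u) -> bijective g.
Proof.
move=> g_inj g_surj.
have g_surjb u : exists t, g t == u.
  by have [t <-] := g_surj u; exists t.
have gK : cancel (fun u => xchoose (g_surjb u)) g.
  by move=> u; apply/eqP/(xchooseP (g_surjb u)).
by exists (fun u => xchoose (g_surjb u)) => // t; apply: g_inj; rewrite gK.
Qed.

Lemma ring_iso_sym (A B : comNzRingType) : ring_iso A B -> ring_iso B A.
Proof.
move=> [f [g fK gK]].
have g_zmod : zmod_morphism g.
  by move=> x y; rewrite -[RHS]fK rmorphB !gK.
have g_monoid : monoid_morphism g.
  split=> [|x y]; first by rewrite -[RHS]fK rmorph1.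
  by rewrite -[RHS]fK rmorphM !gK.
pose gm := HB.pack_for {rmorphism B -> A} g
  (GRing.isZmodMorphism.Build B A g g_zmod)
  (GRing.isMonoidMorphism.Build B A g g_monoid).
by exists gm; exists f.
Qed.

Lemma ring_iso_trans (A B C : comNzRingType) :
  ring_iso A B -> ring_iso B C -> ring_iso A C.
Proof. by move=> [f fb] [g gb]; exists (g \o f); apply: bij_comp. Qed.

(** * Prime and maximal ideals, and their existence *)

Section MaximalIdeals.
Variable A : comNzRingType.
Implicit Types J M Q : {pred A}.

(** Stated with [=] rather than [=i], so that [subst] can turn a bare predicate into a bundled prime
    ideal. *)
Lemma prime_idealr_of Q :
  prime_ideal Q -> exists P : prime_idealr A, (P : {pred A}) = Q.
Proof.
move=> [Qi Qp].
exists (HB.pack_for (prime_idealr A) (Q : A -> bool)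
  (isIdealr.Build A Q Qi) (isPrimeIdealrClosed.Build A Q Qp)).
by [].
Qed.

Lemma idealr_idealr_closed (J : idealr A) : idealr_closed J.
Proof.
split=> [||a u v uJ vJ]; rewrite ?rpred0 ?idealr1 //.
by rewrite rpredD ?idealMr.
Qed.

Lemma prime_idealr_prime (P : prime_idealr A) : prime_ideal P.
Proof.
split; first exact: idealr_idealr_closed.
by move=> u v; rewrite prime_idealrM.
Qed.

Lemma idealr_closedMr J a u : idealr_closed J -> u \in J -> a * u \in J.
Proof. by case=> J0 _ JD uJ; rewrite -[a * u]addr0 JD. Qed.

Lemma idealr_closedD J u v :
  idealr_closed J -> u \in J -> v \in J -> u + v \in J.
Proof. by case=> J0 _ JD uJ vJ; rewrite -[u]mul1r JD. Qed.

Lemma maximal_ideal_eqi M N : M =i N -> maximal_ideal M -> maximal_ideal N.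
Proof.
move=> MN [[M0 M1 MD] Mmax]; split.
  by split; rewrite -?MN // => a u v; rewrite -!MN; apply: MD.
move=> J Ji NJ x; rewrite -MN; apply: Mmax => // y; rewrite MN; exact: NJ.
Qed.

Lemma maximal_ideal_prime M : maximal_ideal M -> prime_ideal M.
Proof.
move=> [Mi Mmax]; split=> // u v uvM; apply: contraT; rewrite negb_or.
move=> /andP[uM vM].
(* The ideal [M + A u]: if it contains 1, then [v] falls into [M]; otherwise maximality puts [u] in
   [M]. *)
pose J : {pred A} := [pred x | `[< exists m a, m \in M /\ x = m + a * u >]].
have MJ : {subset M <= J}.
  by move=> m mM; apply/asboolP; exists m, 0; split=> //; ring.
have J_u : u \in J.
  by apply/asboolP; exists 0, 1; split; [case: Mi | ring].
have [/asboolP[m [a [mM e]]]|J1] := boolP (1 \in J).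
  case/negP: vM.
  have -> : v = v * m + a * (u * v) by rewrite -[LHS]mulr1 e; ring.
  by apply: idealr_closedD => //; apply: idealr_closedMr.
case/negP: uM; rewrite -(Mmax J) //; split=> //; first by apply: MJ; case: Mi.
move=> a _ _ /asboolP[m [b [mM ->]]] /asboolP[n [c [nM ->]]].
apply/asboolP; exists (a * m + n), (a * b + c); split; last by ring.
by apply: idealr_closedD => //; apply: idealr_closedMr.
Qed.

(* Zorn is applied to the sets X such that X \cup J is a proper ideal, so that
   the empty chain needs no special treatment. *)
Lemma maximal_ideal_exists (J : {pred A}) : idealr_closed J ->
  exists2 M : {pred A}, maximal_ideal M & {subset J <= M}.
Proof.
move=> Ji; pose U (X : set A) : {pred A} := [pred a | `[< X a \/ a \in J >]].
have [F FU Ftot|X [UX Xmax]] := @Zorn_bigcup A (fun X => idealr_closed (U X)).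
  split; first by apply/asboolP; right; case: Ji.
    apply/negP => /asboolP[[X FX X1]|]; last by apply/negP; case: Ji.
    by have [_ /negP[]] := FU X FX; apply/asboolP; left.
  have in_bigcup (X : set A) x : F X -> x \in U X ->
      x \in U (\bigcup_(Y in F) Y)%classic.
    move=> FX /asboolP[Xx|xJ]; apply/asboolP; last by right.
    by left; exists X.
  move=> a u v /asboolP[[X FX Xu]|uJ] /asboolP[[Y FY Yv]|vJ].
  - have [XY|YX] := Ftot X Y FX FY.
      have [_ _ YD] := FU Y FY; apply: (in_bigcup Y) => //.
      by apply: YD; apply/asboolP; left=> //; apply: XY.
    have [_ _ XD] := FU X FX; apply: (in_bigcup X) => //.
    by apply: XD; apply/asboolP; left=> //; apply: YX.
  - have [_ _ XD] := FU X FX; apply: (in_bigcup X) => //.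
    by apply: XD; apply/asboolP; [left | right].
  - have [_ _ YD] := FU Y FY; apply: (in_bigcup Y) => //.
    by apply: YD; apply/asboolP; [right | left].
  - apply/asboolP; right.
    by apply: idealr_closedD => //; apply: idealr_closedMr.
exists (U X); last by move=> a aJ; apply/asboolP; right.
split=> // N Ni UN x; apply/idP/idP; last exact: UN.
move=> xN; apply: contraT => /asboolP xU.
case: (Xmax [set a | a \in N]%classic).
  split=> [a Xa|NX]; first by apply: UN; apply/asboolP; left.
  by case: xU; left; apply: NX.
(* Since [N] contains [J], joining [J] to it changes nothing. *)
have UE a : (a \in U [set a | a \in N]%classic) = (a \in N).
  apply/asboolP/idP => [[]//|]; last by left.
  by move=> aJ; apply: UN; apply/asboolP; right.
have [N0 N1 ND] := Ni.
by split; rewrite ?UE // => a u v; rewrite !UE; apply: ND.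
Qed.

(** Some maximal ideal contains [J], and it can only be [M]; properness of [J] is part of
    [idealr_closed]. *)
Lemma local_ideal_sub M J :
  local_with_maximal M -> idealr_closed J -> {subset J <= M}.
Proof.
move=> [_ Muniq] /maximal_ideal_exists[N Nmax JN] x /JN.
by rewrite (Muniq N Nmax).
Qed.

End MaximalIdeals.

(** * Maximal ideals along a surjective homomorphism *)

Section SurjectivePreimage.
Variables (A B : comNzRingType) (f : {rmorphism A -> B}).
Hypothesis f_surj : forall b, exists a, f a = b.

Lemma preim_idealr_closed_prop (M : {pred B}) :
  idealr_closed M -> idealr_closed (preim_ideal f M).
Proof.
move=> [M0 M1 MD]; split=> [||a u v]; rewrite !inE ?rmorph0 ?rmorph1 //.
by rewrite rmorphD rmorphM; apply: MD.
Qed.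

(** A proper ideal above the preimage contains the kernel of [f], so its image is still a proper
    ideal and maximality of [M] applies to that image. *)
Lemma maximal_ideal_preim (M : {pred B}) :
  maximal_ideal M -> maximal_ideal (preim_ideal f M).
Proof.
move=> [Mi Mmax]; split; first exact: preim_idealr_closed_prop.
move=> J Ji MJ; have [J0 J1 JD] := Ji.
have kerJ a : f a = 0 -> a \in J.
  by move=> fa; apply: MJ; rewrite inE fa; case: Mi.
suff fJ : image_set f J =i M.
  move=> x; apply/idP/idP => [xJ|]; last exact: MJ.
  by rewrite inE -fJ; apply/asboolP; exists x.
apply: Mmax; last first.
  move=> b bM; have [a fa] := f_surj b; apply/asboolP; exists a => //.
  by apply: MJ; rewrite inE fa.
split; first by apply/asboolP; exists 0; rewrite ?rmorph0.
  (* If [f a = 1] with [a] in [J], then [1 - a] is in the kernel, hence 1 is in [J]. *)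
  apply/negP => /asboolP[a aJ e]; case/negP: J1.
  rewrite -(subrK a 1); apply: idealr_closedD => //.
  by apply: kerJ; rewrite rmorphB -e rmorph1 subrr.
move=> b _ _ /asboolP[u uJ ->] /asboolP[v vJ ->]; have [a <-] := f_surj b.
by apply/asboolP; exists (a * u + v); rewrite ?rmorphD ?rmorphM // JD.
Qed.

Lemma preim_maximal_ideal (M : {pred B}) : idealr_closed M ->
  maximal_ideal (preim_ideal f M) -> maximal_ideal M.
Proof.
move=> Mi [_ fMmax]; split=> // J Ji MJ b; have [a <-] := f_surj b.
have -> // : (f a \in J) = (a \in preim_ideal f J) by [].
by rewrite fMmax //; [apply: preim_idealr_closed_prop | move=> x; apply: MJ].
Qed.

End SurjectivePreimage.

(** * Homomorphisms induced on quotients *)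

Section QuotientMap.
Variables (A B : comNzRingType) (f : {rmorphism A -> B}).
Variables (I : idealr A) (J : idealr B).
Hypothesis fIJ : forall a, (a \in I) = (f a \in J).

(* The phantom proof argument lets unification find the hypothesis [fIJ] on
   which the morphism instances of [quot_map] depend. *)
Definition quot_map of (forall a, (a \in I) = (f a \in J)) :=
  fun z : {ideal_quot I} => \pi_{ideal_quot J}%qT (f (repr z)).

Lemma quot_map_pi a :
  quot_map fIJ (\pi_{ideal_quot I}%qT a) = \pi_{ideal_quot J}%qT (f a).
Proof.
apply/eqP; rewrite -Quotient.idealrBE -rmorphB -fIJ.
by rewrite Quotient.idealrBE reprK.
Qed.

Fact quot_map_zmod : zmod_morphism (quot_map fIJ).
Proof.
elim/quotW=> x; elim/quotW=> y.
by rewrite -rmorphB !quot_map_pi !rmorphB.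
Qed.

Fact quot_map_monoid : monoid_morphism (quot_map fIJ).
Proof.
split; first by rewrite -(rmorph1 \pi_{ideal_quot I}%qT) quot_map_pi !rmorph1.
elim/quotW=> x; elim/quotW=> y.
by rewrite -rmorphM !quot_map_pi !rmorphM.
Qed.

HB.instance Definition _ := GRing.isZmodMorphism.Build
  {ideal_quot I} {ideal_quot J} (quot_map fIJ) quot_map_zmod.
HB.instance Definition _ := GRing.isMonoidMorphism.Build
  {ideal_quot I} {ideal_quot J} (quot_map fIJ) quot_map_monoid.

(** One direction of [fIJ] makes the map well defined; the converse makes it injective. *)
Lemma quot_map_bij : (forall b, exists a, f a = b) -> bijective (quot_map fIJ).
Proof.
move=> f_surj; apply: bijective_surj.
  elim/quotW=> x; elim/quotW=> y; rewrite !quot_map_pi => /eqP.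
  by rewrite -Quotient.idealrBE -rmorphB -fIJ Quotient.idealrBE => /eqP.
elim/quotW=> b; have [a <-] := f_surj b.
by exists (\pi_{ideal_quot I}%qT a); rewrite quot_map_pi.
Qed.

End QuotientMap.

(** * Computing with fractions in a localization *)

Section LocalizationFractions.
Variables (C : comNzRingType) (S : prime_idealr C).

Lemma locfrac_eqP (a b s t : C) (sS : s \notin S) (tS : t \notin S) :
  locfrac a sS = locfrac b tS <->
  exists2 u, u \notin S & u * (a * t) = u * (b * s).
Proof.
by split=> [/eqP/frac_eqP|e]; [|apply/eqP/frac_eqP].
Qed.

Lemma localizationW (K : localization S -> Prop) :
  (forall a s (sS : s \notin S), K (locfrac a sS)) -> forall z, K z.
Proof. by move=> KS; elim/quotW=> -[[a s] sS]; apply: KS. Qed.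

Lemma locfracB (a b s t : C) (sS : s \notin S) (tS : t \notin S) :
  locfrac a sS - locfrac b tS = locfrac (a * t - b * s) (mul_notin sS tS).
Proof.
rewrite [X in _ + X](_ : _ = locfrac (- b) tS).
  rewrite -[LHS]pi_addf; apply/locfrac_eqP; exists 1; rewrite ?one_notin //=.
  by ring.
by rewrite -[LHS]pi_oppf; apply/locfrac_eqP; exists 1; rewrite ?one_notin.
Qed.

Lemma locfracM (a b s t : C) (sS : s \notin S) (tS : t \notin S) :
  locfrac a sS * locfrac b tS = locfrac (a * b) (mul_notin sS tS).
Proof.
by rewrite -[LHS]pi_mulf; apply/locfrac_eqP; exists 1; rewrite ?one_notin.
Qed.

(** Primality makes membership independent of the fraction chosen: if [u * a * t] is in [S] with [u]
    and [t] outside, then so is [a]. *)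
Lemma mem_loc_ideal (a s : C) (sS : s \notin S) :
  (locfrac a sS \in @loc_ideal C S) = (a \in S).
Proof.
apply/idP/idP => [/loc_idealP[b [t [tS [bS]]]]|aS].
  move=> /locfrac_eqP[u uS e].
  have : u * (a * t) \in S by rewrite e !prime_idealrM bS orbT.
  by rewrite !prime_idealrM (negPf uS) (negPf tS) orbF.
(* The one-term sum [a / s = (1 / s) * (a / 1)]. *)
apply/asboolP; exists 1%N, (fun=> locfrac 1 sS), (fun=> a); split=> //.
rewrite big_ord1 /to_loc locfracM; apply/locfrac_eqP.
by exists 1; rewrite ?one_notin //; ring.
Qed.

End LocalizationFractions.

(** * Homomorphisms induced on localizations and residue fields *)

Section LocalizationMap.
Variables (A B : comNzRingType) (f : {rmorphism A -> B}).
Variables (Q : prime_idealr A) (P : prime_idealr B).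
Hypothesis fQP : forall a, (a \in Q) = (f a \in P).

Fact loc_map_den s : s \notin Q -> f s \notin P.
Proof. by rewrite fQP. Qed.

Definition loc_map (z : localization Q) : localization P :=
  locfrac (f (repr z).1) (loc_map_den (fraction_den (repr z))).

Lemma loc_map_frac a s (sQ : s \notin Q) :
  loc_map (locfrac a sQ) = locfrac (f a) (loc_map_den sQ).
Proof.
have [t tQ e] := frac_repr (mkfrac a sQ).
(* The factor [t] identifies [a / s] with its chosen representative, so [f t] identifies their
   images. *)
apply/locfrac_eqP; exists (f t); first by rewrite -fQP.
by rewrite -!rmorphM e.
Qed.

Lemma loc_map_to_loc a : loc_map (to_loc Q a) = to_loc P (f a).
Proof.
rewrite loc_map_frac; apply/locfrac_eqP; exists 1; rewrite ?one_notin //.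
by rewrite rmorph1.
Qed.

Fact loc_map_zmod : zmod_morphism loc_map.
Proof.
elim/localizationW=> a s sQ; elim/localizationW=> b t tQ.
rewrite locfracB !loc_map_frac locfracB.
by apply/locfrac_eqP; exists 1; rewrite ?one_notin // rmorphB !rmorphM.
Qed.

Fact loc_map_monoid : monoid_morphism loc_map.
Proof.
split; first by rewrite -(rmorph1 (to_loc Q)) loc_map_to_loc !rmorph1.
elim/localizationW=> a s sQ; elim/localizationW=> b t tQ.
rewrite locfracM !loc_map_frac locfracM.
by apply/locfrac_eqP; exists 1; rewrite ?one_notin // !rmorphM.
Qed.

HB.instance Definition _ := GRing.isZmodMorphism.Build
  (localization Q) (localization P) loc_map loc_map_zmod.
HB.instance Definition _ := GRing.isMonoidMorphism.Build
  (localization Q) (localization P) loc_map loc_map_monoid.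

Lemma mem_loc_map z : (z \in @loc_ideal A Q) = (loc_map z \in @loc_ideal B P).
Proof.
by elim/localizationW: z => a s sQ; rewrite loc_map_frac !mem_loc_ideal.
Qed.

(** The map on localizations need not be injective, but it matches the two maximal ideals exactly,
    and lifting numerators and denominators makes it surjective. *)
Lemma residue_field_surj_iso : (forall b, exists a, f a = b) ->
  ring_iso (residue_field Q) (residue_field P).
Proof.
move=> f_surj; exists (quot_map mem_loc_map); apply: quot_map_bij.
elim/localizationW=> b t; have [a <-] := f_surj b; have [s <-] := f_surj t.
move=> sP; have sQ : s \notin Q by rewrite fQP.
exists (locfrac a sQ); rewrite /= loc_map_frac.
by apply/locfrac_eqP; exists 1; rewrite ?one_notin.
Qed.

(* After inverting [e], the map [f] becomes an isomorphism. *)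
Lemma loc_map_bij (e : A) : e \notin Q ->
    (forall b, exists a, f a = f e * b) -> (forall a, f a = 0 -> e * a = 0) ->
  bijective loc_map.
Proof.
move=> eQ f_surj f_inj; have eP : f e \notin P by rewrite -fQP.
apply: bijective_surj.
  elim/localizationW=> a s sQ; elim/localizationW=> b t tQ.
  (* The witness [v] need not be in the image of [f], but [f e * v] is; a further factor [e] then
     kills the kernel. *)
  rewrite !loc_map_frac => /locfrac_eqP[v vP E]; have [u fu] := f_surj v.
  have uQ : u \notin Q by rewrite fQP fu mul_notin.
  apply/locfrac_eqP; exists (e * u); first exact: mul_notin.
  apply/eqP; rewrite -subr_eq0 -!mulrA -!mulrBr f_inj //.
  by rewrite !(rmorphM, rmorphB) fu mulrBr -!mulrA E subrr.
elim/localizationW=> b t tP; have [a fa] := f_surj b; have [s fs] := f_surj t.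
have sQ : s \notin Q by rewrite fQP fs mul_notin.
(* The fraction [b / t] is rewritten as [(f e * b) / (f e * t)], whose two entries lift to [A]. *)
exists (locfrac a sQ); rewrite loc_map_frac; apply/locfrac_eqP.
by exists 1; rewrite ?one_notin // fa fs; ring.
Qed.

End LocalizationMap.

Lemma not_subsetP (T : Type) (A B : {pred T}) :
  ~ {subset A <= B} -> exists2 x, x \in A & x \notin B.
Proof.
move=> AB; apply: contrapT => nAB; apply: AB => x xA; apply: contraT => xB.
by case: nAB; exists x.
Qed.

(** * Ideals of [R ⋈ I] and their contractions *)

Section DuplicationIdeals.
Variables (R : comNzRingType) (I : idealr R).
Implicit Types (P : prime_idealr R) (Q : prime_idealr (R ⋈ I)).

Lemma dup_inclP (r s : R) :
  s - r \in I -> exists x : R ⋈ I, dup_incl I x = (r, s).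
Proof.
move=> rsI; have xI : (r, s) \in dup_set predT I.
  by apply/asboolP; exists r, (s - r); rewrite subrKC.
by exists (Duplication xI).
Qed.

Lemma dup_sub_in (x : R ⋈ I) : (dup_incl I x).2 - (dup_incl I x).1 \in I.
Proof.
case: x => -[r s] /= xI; case/asboolP: (xI) => p [i [_ iI [-> ->]]].
by rewrite [p + i]addrC addrK.
Qed.

Definition dup_proj2 : {rmorphism (R ⋈ I) -> R} := @snd R R \o dup_incl I.

Lemma dup_proj_surj r : exists x : R ⋈ I, dup_proj I x = r.
Proof. by exists (dup_diag I r). Qed.

Lemma dup_proj2_surj r : exists x : R ⋈ I, dup_proj2 x = r.
Proof. by exists (dup_diag I r). Qed.

Lemma residue_field_proj P Q : (Q =i dup_ideal1 I P) ->
  ring_iso (residue_field Q) (residue_field P).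
Proof.
by move=> QP; apply: (@residue_field_surj_iso _ _ (dup_proj I)) dup_proj_surj.
Qed.

Lemma residue_field_proj2 P Q : (Q =i dup_ideal2 I P) ->
  ring_iso (residue_field Q) (residue_field P).
Proof.
by move=> QP; apply: (@residue_field_surj_iso _ _ dup_proj2) dup_proj2_surj.
Qed.

(** The two components of an element of [R ⋈ I] always differ by an element of [I], so only the
    first one is constrained. *)
Lemma dup_ofE (J : {pred R}) : dup_of I J =i dup_ideal1 I J.
Proof.
move=> x; rewrite !inE /dup_proj; apply/asboolP/idP => [[p [i [pJ _ ->]]]//|xJ].
exists (dup_incl I x).1, ((dup_incl I x).2 - (dup_incl I x).1).
by rewrite dup_sub_in subrKC; split=> //; case: (dup_incl I x).
Qed.

Lemma dup_ideal12 P : {subset I <= P} -> dup_ideal1 I P =i dup_ideal2 I P.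
Proof.
move=> IP x; rewrite !inE /dup_proj /=.
have iP := IP _ (dup_sub_in x).
by rewrite -[X in _ = (X \in P)](subrK (dup_incl I x).1) rpredDl.
Qed.

(** For [i] in [I], the element [(0, i)] is always in [P_1], but is in [P_2] only when [i] is in
    [P]. *)
Lemma dup_ideal1_neq2 P : ~ {subset I <= P} ->
  ~ (dup_ideal1 I P =i dup_ideal2 I P).
Proof.
move=> IP e; apply: IP => i iI.
have [|x ex] := @dup_inclP 0 i; first by rewrite subr0.
by have := e x; rewrite !inE /dup_proj ex /= rpred0.
Qed.

(* For [x = (p, p + i)] in the intersection, [(x - (p, p))^2 = (i, i) (0, i)]
   with [i] in [P], so [x ^+ 2] already lies in the extension of [P]. *)
Lemma dup_ideal_radical P : dup_ideal I P =i radical (dup_ideal0 I P).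
Proof.
move=> x; apply/idP/asboolP => [|[n n_gt0 /asboolP[m [c [y [yP e]]]]]].
  rewrite !inE /dup_proj /= => /andP[x1 x2]; exists 2%N => //.
  set p := (dup_incl I x).1 in x1 *; set i := (dup_incl I x).2 - p.
  have iP : i \in P by rewrite rpredB.
  have ie : dup_diag I i * (x - dup_diag I p) = (x - dup_diag I p) ^+ 2.
    apply: val_inj; rewrite -[RHS]/((dup_incl I x - (p, p)) ^+ 2).
    rewrite -[LHS]/((i, i) * (dup_incl I x - (p, p))).
    by rewrite expr2 /i /p; case: (dup_incl I x) => a b; congr pair => /=; ring.
  have in0 a q : q \in P -> a * dup_diag I q \in dup_ideal0 I P.
    move=> qP; apply/asboolP; exists 1%N, (fun=> a), (fun=> q).
    by rewrite big_ord1.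
  (* With [d = (p, p)], this is [x^2 = (x - d)^2 + (2 x - d) d]. *)
  have -> : x ^+ 2 = 1 * ((x - dup_diag I p) * dup_diag I i)
      + (2%:R * x - dup_diag I p) * dup_diag I p.
    by rewrite [_ * dup_diag I i]mulrC ie; ring.
  by apply: ext_idealD; apply: in0.
(* Conversely, a prime containing the diagonal image of [P] contains a power of [x], hence [x]; this
   applies to [P_1] and [P_2]. *)
have mem_x (J : prime_idealr (R ⋈ I)) :
    (forall q, q \in P -> dup_diag I q \in J) -> x \in J.
  move=> PJ; have : x ^+ n \in J.
    by rewrite e; apply: rpred_sum => k _; rewrite idealMr ?PJ.
  case: n n_gt0 {e} => // n _; elim: n => [|n IHn]; first by rewrite expr1.
  by rewrite exprS prime_idealrM => /orP[].
by apply/andP; split; apply: mem_x.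
Qed.

Lemma prime_O1_sub Q : {subset dup_O1 I <= Q} ->
  Q =i dup_ideal1 I (contraction Q).
Proof.
move=> OQ x; rewrite !inE /dup_proj; set d := dup_diag I _.
rewrite -(subrK d x) rpredDl // OQ // !inE /=.
by rewrite subrr eqxx dup_sub_in.
Qed.

(* Since [(x - (x.2, x.2)) * y = 0], the first factor lies in [Q]. *)
Lemma prime_O1_nsub Q (y : R ⋈ I) : y \in dup_O1 I -> y \notin Q ->
  Q =i dup_ideal2 I (contraction Q).
Proof.
rewrite inE => /andP[/eqP y1 _] yQ x; rewrite !inE /=; set d := dup_diag I _.
rewrite -[in LHS](subrK d x) rpredDl //.
have : (x - d) * y \in Q.
  suff -> : (x - d) * y = 0 by rewrite rpred0.
  apply: val_inj; set x2 := (dup_incl I x).2 in d *.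
  rewrite -[LHS]/((dup_incl I x - (x2, x2)) * dup_incl I y) /x2.
  case: (dup_incl I y) y1 => a b /= ->; case: (dup_incl I x) => a' b'.
  by congr pair => /=; ring.
by rewrite prime_idealrM (negPf yQ) orbF.
Qed.

Lemma dup_prime_cases Q :
  Q =i dup_ideal1 I (contraction Q) \/ Q =i dup_ideal2 I (contraction Q).
Proof.
have [/prime_O1_sub|/not_subsetP[y yO /(prime_O1_nsub yO)]] :=
  pselect {subset dup_O1 I <= Q}; by [left | right].
Qed.

Lemma eq_dup_ideal1 (J K : {pred R}) :
  J =i K -> dup_ideal1 I J =i dup_ideal1 I K.
Proof. by move=> JK x; rewrite !inE JK. Qed.

Lemma eq_dup_ideal2 (J K : {pred R}) :
  J =i K -> dup_ideal2 I J =i dup_ideal2 I K.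
Proof. by move=> JK x; rewrite !inE /= JK. Qed.

Lemma maximal_dup_ideal1 (M : {pred R}) :
  maximal_ideal M -> maximal_ideal (dup_ideal1 I M).
Proof. exact/maximal_ideal_preim/dup_proj_surj. Qed.

Lemma dup_ideal2_preim (M : {pred R}) :
  preim_ideal dup_proj2 M =i dup_ideal2 I M.
Proof. by []. Qed.

Lemma maximal_dup_ideal2 (M : {pred R}) :
  maximal_ideal M -> maximal_ideal (dup_ideal2 I M).
Proof.
move=> /(maximal_ideal_preim dup_proj2_surj).
exact: maximal_ideal_eqi (@dup_ideal2_preim M).
Qed.

(** [Q] is the preimage of its contraction under one of the two surjective projections, along which
    maximality descends. *)
Lemma contraction_maximal Q : maximal_ideal Q -> maximal_ideal (contraction Q).
Proof.
have [ci _] := prime_idealr_prime (contraction Q : prime_idealr R).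
move=> Qmax; have [e|e] := dup_prime_cases Q.
  apply: (preim_maximal_ideal dup_proj_surj ci) (maximal_ideal_eqi e Qmax).
apply: (preim_maximal_ideal dup_proj2_surj ci) (maximal_ideal_eqi e Qmax).
Qed.

(** As [I] lies in [M], the ideals [M_1] and [M_2] coincide; any maximal ideal contracts to [M],
    hence is one of them. *)
Lemma local_dup_ideal (M : {pred R}) :
  local_with_maximal M -> local_with_maximal (dup_ideal I M).
Proof.
move=> Mloc; have [Mmax Muniq] := Mloc.
have [P PM] := prime_idealr_of (maximal_ideal_prime Mmax); subst M.
have IP := local_ideal_sub Mloc (idealr_idealr_closed I).
have e1 : dup_ideal1 I P =i dup_ideal I P.
  by move=> x; rewrite [RHS]inE /= -(dup_ideal12 IP) andbb.
split; first exact: maximal_ideal_eqi e1 (maximal_dup_ideal1 Mmax).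
move=> N Nmax.
have [Q QN] := prime_idealr_of (maximal_ideal_prime Nmax); subst N.
have cP := Muniq _ (contraction_maximal Nmax).
have [e|e] := dup_prime_cases Q; move=> x; rewrite e.
  by rewrite -e1; apply: eq_dup_ideal1.
by rewrite -e1 (dup_ideal12 IP); apply: eq_dup_ideal2.
Qed.

Lemma reduced_dup : reduced R <-> reduced (R ⋈ I).
Proof.
split=> [Rred x n xn|Dred r n rn]; last first.
  have : dup_diag I r = 0 by apply: (Dred _ n); rewrite -rmorphXn rn rmorph0.
  by move/(congr1 (dup_proj I)).
have x1 : dup_proj I x = 0.
  by apply: (Rred _ n); rewrite -rmorphXn xn rmorph0.
have x2 : dup_proj2 x = 0.
  by apply: (Rred _ n); rewrite -rmorphXn xn rmorph0.
apply: val_inj; move: x1 x2; rewrite /dup_proj /= -[val x]/(dup_incl I x).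
by case: (dup_incl I x) => a b /= -> ->.
Qed.

(** * Primes of [R * R] and the induced isomorphisms *)

Lemma preim_incl_uniq Q (y : R ⋈ I) (QQ : {pred R * R}) :
  y \in dup_O1 I -> y \notin Q ->
  prime_ideal QQ -> preim_ideal (dup_incl I) QQ =i Q ->
  QQ =i preim_ideal (@snd R R) (contraction Q).
Proof.
rewrite inE => /andP[/eqP y1 _] yQ /prime_idealr_of[S <-] SQ.
(* Here [y = y * (0, 1)] is outside [S], which excludes [(0, 1)]; the orthogonal idempotent [(1, 0)]
   is then forced into [S]. *)
have n01 : ((0, 1) : R * R) \notin S.
  apply: contra yQ => S01; rewrite -SQ inE.
  have -> : dup_incl I y = dup_incl I y * (0, 1); last exact: idealMr.
  by case: (dup_incl I y) y1 => a b /= ->; congr pair => /=; ring.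
have S10 : ((1, 0) : R * R) \in S.
  have : ((1, 0) : R * R) * (0, 1) \in S.
    rewrite (_ : _ * _ = 0) ?rpred0 //; congr pair => /=; ring.
  by rewrite prime_idealrM (negPf n01) orbF.
case=> a b; rewrite !inE -SQ inE /=.
(* Modulo [(1, 0)], the pair [(a, b)] may be replaced by the diagonal [(b, b)], where [S] is known
   through [Q]. *)
rewrite -[in LHS](subrK ((b, b) : R * R) (a, b)) rpredDl //.
have -> : (a, b) - (b, b) = ((a - b, 0) : R * R) * (1, 0).
  by congr pair => /=; ring.
exact: idealMr.
Qed.

Lemma loc_incl_iso Q (QQ : prime_idealr (R * R)%type) (y : R ⋈ I) :
  y \in dup_O1 I -> y \notin Q -> preim_ideal (dup_incl I) QQ =i Q ->
  induces_loc_iso (dup_incl I) Q QQ.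
Proof.
rewrite inE => /andP[/eqP y1 y2] yQ QQQ.
have fQ a : (a \in Q) = (dup_incl I a \in QQ) by rewrite -QQQ.
exists (loc_map fQ); last exact: loc_map_to_loc.
apply: (loc_map_bij fQ yQ) => [[b b']|a a0]; last first.
  by rewrite (_ : a = 0) ?mulr0 //; apply: val_inj.
move: y1 y2 => /=; case: (dup_incl I y) => u v /= -> vI.
(* With [y = (0, v)] and [v] in [I], the product [y * (b, b') = (0, v * b')] lies in [R ⋈ I]. *)
have [|x ex] := @dup_inclP 0 (v * b'); first by rewrite subr0 mulrC idealMr.
by exists x; rewrite /= ex; congr pair => /=; ring.
Qed.

(** Inverting [(0, 1)] kills [R x 0], the kernel of the second projection. *)
Lemma loc_snd_iso (QQ : prime_idealr (R * R)%type) P :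
  QQ =i preim_ideal (@snd R R) P -> induces_loc_iso (@snd R R) QQ P.
Proof.
move=> QQP; exists (loc_map QQP); last exact: loc_map_to_loc.
apply: (@loc_map_bij _ _ _ _ _ QQP ((0, 1) : R * R)).
- by rewrite QQP inE /= idealr1.
- by move=> b; exists (0, b); rewrite mul1r.
- by move=> [a b] /= ->; congr pair => /=; ring.
Qed.

Lemma quot_proj_iso Q P :
  Q =i preim_ideal (dup_proj I) P -> induces_quot_iso (dup_proj I) Q P.
Proof.
move=> QP; exists (quot_map QP); last exact: quot_map_pi.
exact/quot_map_bij/dup_proj_surj.
Qed.

End DuplicationIdeals.

Theorem theorem3p5 (R : comNzRingType) (I : idealr R)
    (I_neq0 : exists2 i : R, i \in I & i != 0) :
  (* (1) *)
  [/\ forall P : prime_idealr R,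
      [/\ (* (1,a) *)
          forall Q : {pred R ⋈ I},
            (prime_ideal Q /\ contraction Q =i P) <->
            (Q =i dup_ideal1 I P \/ Q =i dup_ideal2 I P),
          (* (1,b) *)
          {subset I <= P} ->
            [/\ dup_ideal1 I P =i dup_ideal2 I P,
                dup_ideal2 I P =i dup_ideal I P,
                dup_ideal I P =i radical (dup_ideal0 I P),
                radical (dup_ideal0 I P) =i dup_of I P
              & exists2 PP : prime_idealr (R ⋈ I), PP =i dup_ideal I P &
                  ring_iso (residue_field P) (residue_field PP)],
          (* (1,c) *)
          ~ {subset I <= P} ->
            [/\ ~ (dup_ideal1 I P =i dup_ideal2 I P),
                dup_ideal I P =i radical (dup_ideal0 I P),
                ring_iso (residue_field P) (residue_field (dup_ideal1 I P))
              & ring_iso (residue_field (dup_ideal1 I P))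
                         (residue_field (dup_ideal2 I P))]
        & (* (1,d) *)
          maximal_ideal P ->
            maximal_ideal (dup_ideal1 I P) /\ maximal_ideal (dup_ideal2 I P)],
      (* (1,e) *)
      forall M : {pred R}, local_with_maximal M ->
        [/\ local_with_maximal (dup_ideal I M),
            dup_ideal I M =i radical (dup_ideal0 I M)
          & radical (dup_ideal0 I M) =i dup_of I M]
    & (* (1,f) *)
      reduced R <-> reduced (R ⋈ I)] /\
  (* (2) *)
  forall Q : prime_idealr (R ⋈ I),
    (* (2,a) *)
    (~ {subset dup_O1 I <= Q} ->
      let P : prime_idealr R := contraction Q in
      [/\ exists QQ : prime_idealr (R * R)%type,
            [/\ preim_ideal (dup_incl I) QQ =i Q,
                forall QQ' : {pred R * R}, prime_ideal QQ' ->
                  preim_ideal (dup_incl I) QQ' =i Q -> QQ' =i QQ,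
                QQ =i [predX predT & P],
                induces_loc_iso (dup_incl I) Q QQ
              & induces_loc_iso (@snd R R) QQ P],
          ~ {subset I <= P},
          ~ (dup_ideal1 I P =i dup_ideal2 I P),
          Q =i dup_ideal2 I P
        & (forall x : R ⋈ I,
             x \in Q <-> exists p i, [/\ p \in P, i \in I
                                       & dup_incl I x = (p + i, p)]) /\
          ring_iso (residue_field Q) (residue_field P)]) /\
    (* (2,b) *)
    ({subset dup_O1 I <= Q} ->
      exists P : prime_idealr R,
        [/\ Q =i preim_ideal (dup_proj I) P,
            forall P' : {pred R}, prime_ideal P' ->
              Q =i preim_ideal (dup_proj I) P' -> P' =i P,
            forall P' : {pred R}, prime_ideal P' ->
              (Q =i preim_ideal (dup_proj I) P' <->
               P' =i image_set (dup_proj I) Q),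
            ({subset I <= P} ->
               Q =i dup_ideal1 I P /\ dup_ideal1 I P =i dup_ideal2 I P) /\
            (~ {subset I <= P} ->
               Q =i dup_ideal1 I P /\ ~ (dup_ideal1 I P =i dup_ideal2 I P))
          & [/\ Q =i dup_of I P,
                induces_quot_iso (dup_proj I) Q P
              & ring_iso (residue_field Q) (residue_field P)]]).
Proof.
split.
  split=> [P|M Mloc|]; last exact: reduced_dup.
    split=> [Q|IP|IP|Pmax].
    - split=> [[/prime_idealr_of[S <-] cP]|].
        have [e|e] := dup_prime_cases S; [left|right] => x; rewrite e.
          exact: eq_dup_ideal1.
        exact: eq_dup_ideal2.
      case=> e.
        split; last by move=> r; rewrite inE e.
        have [[i0 i1 iD] p] := prime_idealr_prime (dup_ideal1 I P).
        split; first by split; rewrite ?e // => a u v; rewrite !e; apply: iD.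
        by move=> u v; rewrite !e; apply: p.
      split; last by move=> r; rewrite inE e !inE.
      have [[i0 i1 iD] p] := prime_idealr_prime (dup_ideal2 I P).
      split; first by split; rewrite ?e // => a u v; rewrite !e; apply: iD.
      by move=> u v; rewrite !e; apply: p.
    - have e12 := dup_ideal12 IP.
      have e1 : dup_ideal1 I P =i dup_ideal I P.
        by move=> x; rewrite [RHS]inE /= -e12 andbb.
      split=> [//|x|||].
      + by rewrite -e12 e1.
      + exact: dup_ideal_radical.
      + by move=> x; rewrite dup_ofE e1 dup_ideal_radical.
      (* The intersection is a bare predicate; the equal ideal [dup_ideal1 I P] carries the prime
         structure. *)
      + exists (dup_ideal1 I P) => //.
        exact/ring_iso_sym/residue_field_proj.
    - split; [exact: dup_ideal1_neq2 | exact: dup_ideal_radical | |].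
        exact/ring_iso_sym/residue_field_proj.
      apply: ring_iso_trans (residue_field_proj _) _ => //.
      exact/ring_iso_sym/residue_field_proj2.
    - by split; [apply: maximal_dup_ideal1 | apply: maximal_dup_ideal2].
  have [Mmax _] := Mloc.
  have [P PM] := prime_idealr_of (maximal_ideal_prime Mmax); subst M.
  have IP := local_ideal_sub Mloc (idealr_idealr_closed I).
  split; [exact: local_dup_ideal | exact: dup_ideal_radical | move=> x].
  by rewrite -dup_ideal_radical dup_ofE [LHS]inE /= -(dup_ideal12 IP) andbb.
move=> Q; split=> [nOQ P|OQ].
  have [y yO yQ] := not_subsetP nOQ.
  have QP2 : Q =i dup_ideal2 I P := prime_O1_nsub yO yQ.
  have nIP : ~ {subset I <= P}.
    (* If [I] were inside [P], the second component of [y] would be in [P], so [y] would be in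
       [P_2 = Q]. *)
    move=> IP; case/negP: yQ; rewrite QP2 inE.
    by move: yO; rewrite !inE => /andP[_] /IP.
  split=> //; [|exact: dup_ideal1_neq2|split].
  - exists (preim_ideal (@snd R R) P).
    have e : preim_ideal (dup_incl I) (preim_ideal (@snd R R) P) =i Q.
      by move=> x; rewrite QP2.
    split=> //; [|exact: loc_incl_iso yO yQ e|exact: loc_snd_iso].
    by move=> QQ' /(preim_incl_uniq yO yQ); apply.
  - move=> x; rewrite QP2 !inE /=; split=> [xP|[p [i [pP _ ->]]]//].
    exists (dup_incl I x).2, ((dup_incl I x).1 - (dup_incl I x).2).
    rewrite subrKC -opprB rpredN dup_sub_in; split=> //.
    by case: (dup_incl I x).
  - exact: residue_field_proj2.
have QP1 := prime_O1_sub OQ.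
exists (contraction Q).
(* Evaluating at diagonal elements [(r, r)] recovers [P'] from its preimage. *)
have uniq (P' : {pred R}) :
    Q =i preim_ideal (dup_proj I) P' -> P' =i contraction Q.
  by move=> e r; rewrite !inE e inE.
have imQ : image_set (dup_proj I) Q =i contraction Q.
  move=> r; apply/asboolP/idP => [[x xQ ->]|rQ]; first by rewrite QP1 in xQ.
  by exists (dup_diag I r).
split=> //.
- by move=> P' _; apply: uniq.
- move=> P' _; split=> [/uniq e r|e x]; first by rewrite imQ e.
  by rewrite QP1 !inE e imQ.
- by split=> IP; split=> //; [apply: dup_ideal12 | apply: dup_ideal1_neq2].
- split; [|exact: quot_proj_iso|exact: residue_field_proj].
  by move=> x; rewrite QP1 dup_ofE.
Qed.
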